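(* Let $L$ be a finite residuated lattice. Then the profinite completion $\widehat{L}$ of $L$ is (canonically isomorphic to) the inverse limit $\varprojlim_{F\in\mathcal{JF}(L)\cup\{\{1\}\}}L/F$ of the inverse system $\{L/F,\ \varphi_{FG}\}$ indexed by the directed poset $(\mathcal{JF}(L)\cup\{\{1\}\},\supseteq)$, where $\varphi_{FG}(x/F)=x/G$ for $F\subseteq G$.
   Context: A residuated lattice is an algebra $(L,\wedge,\vee,\odot,\rightarrow,0,1)$ such that $(L,\wedge,\vee,0,1)$ is a bounded lattice, $(L,\odot,1)$ is a commutative monoid, and $x\odot y\le z$ iff $x\le y\rightarrow z$. A filter is a nonempty subset closed under $\odot$ and upward closed; for a filter $F$, $x/F$ is the class of $x$ under the congruence $\theta_F=\{(x,y):(x\rightarrow y)\odot(y\rightarrow x)\in F\}$ and $L/F$ is the quotient residuated lattice. A filter $J$ is join-irreducible if $J\ne\{1\}$ and $J=F\vee G$ (filter generated by $F\cup G$) implies $J=F$ or $J=G$; $\mathcal{JF}(L)$ is the set of join-irreducible filters. The inverse limit of an inverse system $\{A_i,\varphi_{ij},I\}$ is $\{(a_i)\in\prod_i A_i:\varphi_{ij}(a_i)=a_j\ \forall j\le i\}$. The profinite completion $\widehat{L}$ is the inverse limit of the system $\{L/F\}$ indexed by all filters $F$ with $L/F$ finite, ordered by $\supseteq$, with the canonical maps $x/F\mapsto x/G$ for $F\subseteq G$. *)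

(* Defs.v *)
Set Warnings "-notation-overridden,-notation-incompatible-prefix".
From HB Require Import structures.
From mathcomp Require Import all_boot all_order.
From mathcomp Require Import boolp classical_sets functions cardinality.

Set Implicit Arguments.
Unset Strict Implicit.
Unset Printing Implicit Defensive.

Import Order.TTheory.
Local Open Scope order_scope.

HB.mixin Record isResiduated d L of Order.TBLattice d L := {
  rmul : L -> L -> L;
  rimp : L -> L -> L;
  rmulA : associative rmul;
  rmulC : commutative rmul;
  rmul1x : left_id (\top : L) rmul;
  rmul_le : forall x y z : L, (rmul x y <= z) = (x <= rimp y z)
}.

#[short(type="residuatedLatticeType")]
HB.structure Definition ResiduatedLattice d :=
  {L of Order.TBLattice d L & isResiduated d L}.

Declare Scope residuated_scope.
Delimit Scope residuated_scope with RL.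
Reserved Notation "x ⊙ y" (at level 40, left associativity).
Reserved Notation "x ⇒ y" (at level 55, right associativity).
Notation "x ⊙ y" := (rmul x y) : residuated_scope.
Notation "x ⇒ y" := (rimp x y) : residuated_scope.
Local Open Scope residuated_scope.

Record residuated_morphism d d' (L : residuatedLatticeType d)
    (M : residuatedLatticeType d') (f : L -> M) : Prop := ResiduatedMorphism {
  residuated_morphism_meet : Order.meet_morphism f;
  residuated_morphism_join : Order.join_morphism f;
  residuated_morphism_mul : {morph f : x y / x ⊙ y};
  residuated_morphism_imp : {morph f : x y / x ⇒ y};
  residuated_morphism_bot : f \bot = \bot;
  residuated_morphism_top : f \top = \top
}.

Definition residuated_isomorphism d d' (L : residuatedLatticeType d)
    (M : residuatedLatticeType d') (f : L -> M) : Prop :=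
  residuated_morphism f /\ bijective f.

Section Residuation.
Context d (L : residuatedLatticeType d).
Implicit Types x y z : L.

Lemma rmulx1 x : x ⊙ \top = x. Proof. by rewrite rmulC rmul1x. Qed.

Lemma rimp_mul x y : (x ⇒ y) ⊙ x <= y. Proof. by rewrite rmul_le. Qed.

Lemma rmul_lel x y z : x <= y -> x ⊙ z <= y ⊙ z.
Proof. by move=> xy; rewrite rmul_le (le_trans xy)// -rmul_le. Qed.

Lemma rmul_ler x y z : x <= y -> z ⊙ x <= z ⊙ y.
Proof. by rewrite ![z ⊙ _]rmulC; exact: rmul_lel. Qed.

Lemma rmul_leL x y : x ⊙ y <= x.
Proof. by rewrite -[leRHS]rmulx1 rmul_ler// lex1. Qed.

Lemma rmul_leR x y : x ⊙ y <= y.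
Proof. by rewrite rmulC rmul_leL. Qed.

Lemma rmulAC x y z : x ⊙ y ⊙ z = x ⊙ z ⊙ y.
Proof. by rewrite -!rmulA (rmulC y). Qed.

Lemma rimp_top x y : x <= y -> x ⇒ y = \top.
Proof. by move=> xy; apply/eqP; rewrite -le1x -rmul_le rmul1x. Qed.

Lemma rimpxx x : x ⇒ x = \top. Proof. exact: rimp_top. Qed.

Lemma rimp_trans x y z : (x ⇒ y) ⊙ (y ⇒ z) <= x ⇒ z.
Proof.
rewrite -rmul_le rmulAC; apply: le_trans (rimp_mul y z).
by rewrite [leRHS]rmulC rmul_lel// rimp_mul.
Qed.

Lemma rimp_curry x y z : x ⊙ y ⇒ z = x ⇒ y ⇒ z.
Proof.
apply/eqP; rewrite eq_le; apply/andP; split.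
  by rewrite -!rmul_le -rmulA rimp_mul.
by rewrite -rmul_le rmulA rmul_le rimp_mul.
Qed.

End Residuation.

Section Filters.
Context d (L : residuatedLatticeType d).
Local Open Scope classical_set_scope.

Record is_filter (A : set L) : Prop := IsFilter {
  is_filter_neq0 : A !=set0;
  is_filter_mul : forall x y, A x -> A y -> A (x ⊙ y);
  is_filter_up : forall x y, A x -> (x <= y)%O -> A y
}.

Record lfilter := MkFilter {
  filter_set :> set L;
  filterP : is_filter filter_set
}.

Definition filter_mem (F : lfilter) : L -> Prop := filter_set F.
Coercion filter_mem : lfilter >-> Funclass.

End Filters.

Section FilterTheory.
Context d (L : residuatedLatticeType d).
Implicit Types F G : lfilter L.

Lemma filter_inj F G : (F : set L) = G -> F = G.
Proof.
case: F G => [A hA] [B hB] /= AB; case: B / AB hB => hB.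
by rewrite (Prop_irrelevance hA hB).
Qed.

Lemma filter_mul F x y : F x -> F y -> F (x ⊙ y).
Proof. exact: is_filter_mul (filterP F) _ _. Qed.

Lemma filter_up F x y : x <= y -> F x -> F y.
Proof. by move=> xy Fx; exact: is_filter_up (filterP F) _ _ Fx xy. Qed.

Lemma filter1 F : F \top.
Proof. by have [x Fx] := is_filter_neq0 (filterP F); apply: filter_up Fx; exact: lex1. Qed.

Lemma filter_mulE F x y : F (x ⊙ y) <-> F x /\ F y.
Proof.
split=> [Fxy|[]]; last exact: filter_mul.
by split; apply: filter_up Fxy; [exact: rmul_leL|exact: rmul_leR].
Qed.

Lemma filter_imp_trans F x y z : F (x ⇒ y) -> F (y ⇒ z) -> F (x ⇒ z).
Proof. by move=> h1 h2; exact: filter_up (rimp_trans x y z) (filter_mul h1 h2). Qed.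

Lemma filter_imp_le F x y : x <= y -> F (x ⇒ y).
Proof. by move=> xy; rewrite rimp_top//; exact: filter1. Qed.

End FilterTheory.

Section FilterExamples.
Context d (L : residuatedLatticeType d).
Local Open Scope classical_set_scope.

Lemma is_filter_trivial : is_filter [set \top%O : L].
Proof.
split; first by exists (\top%O).
  by move=> x y -> ->; rewrite /= rmul1x.
by move=> x y ->; rewrite le1x => /eqP.
Qed.
Definition trivial_filter : lfilter L := MkFilter is_filter_trivial.

Lemma is_filterT : is_filter [set: L].
Proof. by split => //; exists (\top%O). Qed.
Definition full_filter : lfilter L := MkFilter is_filterT.

Lemma is_filterI (F G : lfilter L) : is_filter (F `&` G).
Proof.
split; first by exists (\top%O); split; exact: filter1.
  by move=> x y [? ?] [? ?]; split; exact: filter_mul.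
by move=> x y [? ?] xy; split; apply: filter_up xy _.
Qed.
Definition filter_meet (F G : lfilter L) : lfilter L := MkFilter (is_filterI F G).

Lemma is_filter_smallest (A : set L) : is_filter (smallest (@is_filter d L) A).
Proof.
split; first by exists (\top%O) => B [hB _]; exact: (filter1 (MkFilter hB)).
  move=> x y hx hy B hB; have [BF _] := hB.
  by apply: is_filter_mul BF _ _ _ _; [exact: hx|exact: hy].
by move=> x y hx xy B hB; have [BF _] := hB; apply: is_filter_up BF _ _ (hx _ hB) xy.
Qed.
Definition generated_filter (A : set L) : lfilter L :=
  MkFilter (is_filter_smallest A).

Definition filter_join (F G : lfilter L) : lfilter L :=
  generated_filter (F `|` G).

Definition join_irreducible (J : lfilter L) : Prop :=
  J <> trivial_filter /\
  forall F G : lfilter L, J = filter_join F G -> J = F \/ J = G.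

End FilterExamples.
Arguments trivial_filter {d} L.
Arguments full_filter {d} L.

(* Filters are ordered by reverse inclusion, as the index poset of a system
   of quotients. *)
Section FilterOrder.
Context d (L : residuatedLatticeType d).

HB.instance Definition _ := gen_eqMixin (lfilter L).
HB.instance Definition _ := gen_choiceMixin (lfilter L).

Definition filter_le (F G : lfilter L) : bool := `[< (G `<=` F)%classic >].

Lemma filter_le_refl : reflexive filter_le.
Proof. by move=> F; apply/asboolP. Qed.

Lemma filter_le_anti : antisymmetric filter_le.
Proof.
move=> F G /andP[/asboolP GF /asboolP FG].
by apply: filter_inj; apply/seteqP; split.
Qed.

Lemma filter_le_trans : transitive filter_le.
Proof.
move=> G F H /asboolP GF /asboolP HG; apply/asboolP.
exact: subset_trans HG GF.
Qed.

HB.instance Definition _ := Order.Le_isPOrder.Build d (lfilter L)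
  filter_le_refl filter_le_anti filter_le_trans.

Lemma filter_leP (F G : lfilter L) : reflect (G `<=` F)%classic (F <= G).
Proof. exact: asboolP. Qed.

End FilterOrder.

Section Quotient.
Context d (L : residuatedLatticeType d) (F : lfilter L).
Implicit Types x y z : L.

Definition theta : rel L := fun x y => `[< F ((x ⇒ y) ⊙ (y ⇒ x)) >].

Lemma thetaP x y : reflect (F (x ⇒ y) /\ F (y ⇒ x)) (theta x y).
Proof. by apply: (iffP (asboolP _)) => /filter_mulE. Qed.

Lemma theta_refl : reflexive theta.
Proof. by move=> x; apply/thetaP; rewrite rimpxx; split; exact: filter1. Qed.

Lemma theta_sym : symmetric theta.
Proof. by move=> x y; apply/thetaP/thetaP => -[]. Qed.

Lemma theta_trans : transitive theta.
Proof.
move=> y x z /thetaP[xy yx] /thetaP[yz zy]; apply/thetaP.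
by split; [exact: filter_imp_trans xy yz|exact: filter_imp_trans zy yx].
Qed.

Canonical theta_equiv := EquivRel theta theta_refl theta_sym theta_trans.

Definition quotient : Type := {eq_quot theta_equiv}%qT.
HB.instance Definition _ := Choice.on quotient.
HB.instance Definition _ := EqQuotient.on quotient.

Definition quot_class x : quotient := (\pi_quotient x)%qT.

Lemma quot_classP x y : quot_class x = quot_class y <-> theta x y.
Proof. by split => [/eqmodP|xy] //; apply/eqmodP. Qed.

Lemma quot_classK (c : quotient) : quot_class (repr c) = c.
Proof. exact: reprK. Qed.

Lemma quotW (P : quotient -> Prop) : (forall x, P (quot_class x)) -> forall c, P c.
Proof. by move=> h c; rewrite -[c]quot_classK. Qed.

Definition quot_op (op : L -> L -> L) (a b : quotient) : quotient :=
  quot_class (op (repr a) (repr b)).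

Lemma theta_repr x : theta (repr (quot_class x)) x.
Proof. by apply/quot_classP; rewrite quot_classK. Qed.

Lemma quot_opE op :
    (forall x x' y y', theta x x' -> theta y y' -> F (op x y ⇒ op x' y')) ->
  forall x y, quot_op op (quot_class x) (quot_class y) = quot_class (op x y).
Proof.
move=> h x y; apply/quot_classP/thetaP; have := theta_repr; split.
  by apply: h.
by apply: h; rewrite theta_sym.
Qed.

Lemma quot_meetE x y :
  quot_op Order.meet (quot_class x) (quot_class y) = quot_class (x `&` y).
Proof.
apply: quot_opE => {}x x' {}y y' /thetaP[xx' _] /thetaP[yy' _].
apply: filter_up (filter_mul xx' yy'); rewrite -rmul_le lexI; apply/andP; split.
  rewrite rmulAC; apply: le_trans (rmul_leL _ _) _.
  exact: le_trans (rmul_ler _ (leIl x y)) (rimp_mul _ _).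
rewrite -rmulA; apply: le_trans (rmul_leR _ _) _.
exact: le_trans (rmul_ler _ (leIr y x)) (rimp_mul _ _).
Qed.

Lemma quot_joinE x y :
  quot_op Order.join (quot_class x) (quot_class y) = quot_class (x `|` y).
Proof.
apply: quot_opE => {}x x' {}y y' /thetaP[xx' _] /thetaP[yy' _].
apply: filter_up (filter_mul xx' yy').
rewrite -rmul_le rmulC rmul_le leUx -!rmul_le; apply/andP; split.
  rewrite rmulC rmulAC; apply: le_trans (rmul_leL _ _) _.
  exact: le_trans (rimp_mul _ _) (leUl _ _).
rewrite rmulC -rmulA; apply: le_trans (rmul_leR _ _) _.
exact: le_trans (rimp_mul _ _) (leUr _ _).
Qed.

Lemma quot_mulE x y :
  quot_op (@rmul d L) (quot_class x) (quot_class y) = quot_class (x ⊙ y).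
Proof.
apply: quot_opE => {}x x' {}y y' /thetaP[xx' _] /thetaP[yy' _].
apply: filter_up (filter_mul xx' yy').
rewrite -rmul_le rmulA (rmulAC (x ⇒ x')) -rmulA.
exact: le_trans (rmul_lel _ (rimp_mul _ _)) (rmul_ler _ (rimp_mul _ _)).
Qed.

Lemma quot_impE x y :
  quot_op (@rimp d L) (quot_class x) (quot_class y) = quot_class (x ⇒ y).
Proof.
apply: quot_opE => {}x x' {}y y' /thetaP[_ x'x] /thetaP[yy' _].
apply: filter_up (filter_mul x'x yy').
rewrite -!rmul_le.
rewrite (rmulC (x' ⇒ x)) (rmulAC (y ⇒ y')) -(rmulA ((y ⇒ y') ⊙ _)) -rmulA.
apply: le_trans (rmul_ler _ (rmul_ler _ (rimp_mul _ _))) _.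
exact: le_trans (rmul_ler _ (rimp_mul _ _)) (rimp_mul _ _).
Qed.

Let quot_le : rel quotient := fun a b => quot_op Order.meet a b == a.

Lemma quot_meetC : commutative (quot_op Order.meet).
Proof.
by elim/quotW => x; elim/quotW => y; rewrite !quot_meetE meetC.
Qed.

Lemma quot_meetA : associative (quot_op Order.meet).
Proof.
by elim/quotW => x; elim/quotW => y; elim/quotW => z; rewrite !quot_meetE meetA.
Qed.

Lemma quot_joinC : commutative (quot_op Order.join).
Proof.
by elim/quotW => x; elim/quotW => y; rewrite !quot_joinE joinC.
Qed.

Lemma quot_joinA : associative (quot_op Order.join).
Proof.
by elim/quotW => x; elim/quotW => y; elim/quotW => z; rewrite !quot_joinE joinA.
Qed.

Lemma quot_joinKI b a : quot_op Order.meet a (quot_op Order.join a b) = a.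
Proof.
by elim/quotW: a => x; elim/quotW: b => y; rewrite quot_joinE quot_meetE joinKI.
Qed.

Lemma quot_meetKU b a : quot_op Order.join a (quot_op Order.meet a b) = a.
Proof.
by elim/quotW: a => x; elim/quotW: b => y; rewrite quot_meetE quot_joinE meetKU.
Qed.

Lemma quot_le_refl : reflexive quot_le.
Proof. by elim/quotW => x; rewrite /quot_le quot_meetE meetxx. Qed.

Lemma quot_le_anti : antisymmetric quot_le.
Proof.
by move=> a b /andP[/eqP ab /eqP ba]; rewrite -ab quot_meetC.
Qed.

Lemma quot_le_trans : transitive quot_le.
Proof.
move=> b a c /eqP ab /eqP bc; apply/eqP.
by rewrite -ab -quot_meetA bc.
Qed.

HB.instance Definition _ := Order.Le_isPOrder.Build d quotient
  quot_le_refl quot_le_anti quot_le_trans.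

HB.instance Definition _ := Order.POrder_isLattice.Build d quotient
  quot_meetC quot_joinC quot_meetA quot_joinA quot_joinKI quot_meetKU
  (fun _ _ => erefl).

Lemma quot_class_le x y : (quot_class x <= quot_class y) = `[< F (x ⇒ y) >].
Proof.
rewrite leEmeet -[_ `&` _]/(quot_op _ _ _) quot_meetE; apply/eqP/asboolP.
  move=> /quot_classP/thetaP[_ h].
  by apply: filter_imp_trans h (filter_imp_le _ _); exact: leIr.
move=> h; apply/quot_classP/thetaP; split; first exact/filter_imp_le/leIl.
by apply: filter_up h; rewrite -rmul_le lexI rmul_leR rimp_mul.
Qed.

Lemma quot_le0x (a : quotient) : quot_class \bot <= a.
Proof.
elim/quotW: a => x; rewrite quot_class_le.
by apply/asboolP/filter_imp_le/le0x.
Qed.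

Lemma quot_lex1 (a : quotient) : a <= quot_class \top.
Proof.
elim/quotW: a => x; rewrite quot_class_le.
by apply/asboolP/filter_imp_le/lex1.
Qed.

HB.instance Definition _ := Order.hasBottom.Build d quotient quot_le0x.
HB.instance Definition _ := Order.hasTop.Build d quotient quot_lex1.

Lemma quot_mulA : associative (quot_op (@rmul d L)).
Proof.
by elim/quotW => x; elim/quotW => y; elim/quotW => z; rewrite !quot_mulE rmulA.
Qed.

Lemma quot_mulC : commutative (quot_op (@rmul d L)).
Proof.
by elim/quotW => x; elim/quotW => y; rewrite !quot_mulE rmulC.
Qed.

Lemma quot_mul1x : left_id (\top : quotient) (quot_op (@rmul d L)).
Proof. by elim/quotW => x; rewrite quot_mulE rmul1x. Qed.

Lemma quot_mul_le (a b c : quotient) :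
  (quot_op (@rmul d L) a b <= c) = (a <= quot_op (@rimp d L) b c).
Proof.
elim/quotW: a => x; elim/quotW: b => y; elim/quotW: c => z.
by rewrite quot_mulE quot_impE !quot_class_le rimp_curry.
Qed.

HB.instance Definition _ := isResiduated.Build d quotient
  quot_mulA quot_mulC quot_mul1x quot_mul_le.

Lemma quot_class_morphism : residuated_morphism quot_class.
Proof.
split=> //.
- by move=> x y; exact/esym/quot_meetE.
- by move=> x y; exact/esym/quot_joinE.
- by move=> x y; exact/esym/quot_mulE.
- by move=> x y; exact/esym/quot_impE.
Qed.

End Quotient.

Section QuotientMap.
Context d (L : residuatedLatticeType d).
Implicit Types F G H : lfilter L.

Definition quot_map F G (FG : (F `<=` G)%classic) (c : quotient F) : quotient G :=
  quot_class G (repr c).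

Lemma quot_mapE F G (FG : (F `<=` G)%classic) (x : L) :
  quot_map FG (quot_class F x) = quot_class G x.
Proof.
apply/quot_classP/thetaP; have /thetaP[h1 h2] := theta_repr F x.
by split; apply: FG.
Qed.

Lemma quot_map_morphism F G (FG : (F `<=` G)%classic) :
  residuated_morphism (quot_map FG).
Proof.
have [pFm pFj pFM pFi pF0 pF1] := quot_class_morphism F.
have [pGm pGj pGM pGi pG0 pG1] := quot_class_morphism G.
split.
- by elim/quotW => x; elim/quotW => y; rewrite -pFm !quot_mapE pGm.
- by elim/quotW => x; elim/quotW => y; rewrite -pFj !quot_mapE pGj.
- by elim/quotW => x; elim/quotW => y; rewrite -pFM !quot_mapE pGM.
- by elim/quotW => x; elim/quotW => y; rewrite -pFi !quot_mapE pGi.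
- by rewrite -pF0 quot_mapE pG0.
- by rewrite -pF1 quot_mapE pG1.
Qed.

Lemma quot_map_id F (FF : (F `<=` F)%classic) (c : quotient F) :
  quot_map FF c = c.
Proof. exact: quot_classK. Qed.

Lemma quot_map_comp F G H (FG : (F `<=` G)%classic) (GH : (G `<=` H)%classic)
    (FH : (F `<=` H)%classic) (c : quotient F) :
  quot_map GH (quot_map FG c) = quot_map FH c.
Proof. by elim/quotW: c => x; rewrite !quot_mapE. Qed.

End QuotientMap.

Definition directed_poset d (I : porderType d) : Prop :=
  (exists i : I, True) /\ forall i j : I, exists k : I, i <= k /\ j <= k.

Record inverse_system dI d (I : porderType dI) := InverseSystem {
  sys_directed : directed_poset I;
  sys_obj :> I -> residuatedLatticeType d;
  sys_map : forall i j : I, j <= i -> sys_obj i -> sys_obj j;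
  sys_map_morphism :
    forall (i j : I) (ji : j <= i), residuated_morphism (sys_map ji);
  sys_map_id : forall (i : I) (ii : i <= i) (x : sys_obj i), sys_map ii x = x;
  sys_map_comp :
    forall (i j k : I) (ji : j <= i) (kj : k <= j) (ki : k <= i) (x : sys_obj i),
      sys_map kj (sys_map ji x) = sys_map ki x
}.

Section InverseLimit.
Context dI d (I : porderType dI) (A : inverse_system d I).

Record inverse_limit := InverseLimit {
  lim_proj :> forall i : I, A i;
  lim_compat :
    forall (i j : I) (ji : j <= i), sys_map ji (lim_proj i) = lim_proj j
}.

Implicit Types a b c : inverse_limit.

Lemma lim_ext a b : (forall i, a i = b i) -> a = b.
Proof.
case: a b => [a ha] [b hb] /= ab.
have {}ab : a = b by exact: functional_extensionality_dep.
by case: b / ab hb => hb; rewrite (Prop_irrelevance ha hb).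
Qed.

HB.instance Definition _ := gen_eqMixin inverse_limit.
HB.instance Definition _ := gen_choiceMixin inverse_limit.

Let lim_le : rel inverse_limit := fun a b => `[< forall i, a i <= b i >].

Lemma lim_le_refl : reflexive lim_le.
Proof. by move=> a; apply/asboolP. Qed.

Lemma lim_le_anti : antisymmetric lim_le.
Proof.
move=> a b /andP[/asboolP ab /asboolP ba]; apply: lim_ext => i.
by apply/le_anti; rewrite ab ba.
Qed.

Lemma lim_le_trans : transitive lim_le.
Proof.
move=> b a c /asboolP ab /asboolP bc; apply/asboolP => i.
exact: le_trans (ab i) (bc i).
Qed.

HB.instance Definition _ := Order.Le_isPOrder.Build d inverse_limit
  lim_le_refl lim_le_anti lim_le_trans.

Lemma lim_leP a b : reflect (forall i, a i <= b i) (a <= b).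
Proof. exact: asboolP. Qed.

Definition lim_meet a b : inverse_limit :=
  @InverseLimit (fun i => a i `&` b i) (fun i j ji =>
    etrans (residuated_morphism_meet (sys_map_morphism A ji) (a i) (b i))
           (f_equal2 _ (lim_compat a ji) (lim_compat b ji))).

Definition lim_join a b : inverse_limit :=
  @InverseLimit (fun i => a i `|` b i) (fun i j ji =>
    etrans (residuated_morphism_join (sys_map_morphism A ji) (a i) (b i))
           (f_equal2 _ (lim_compat a ji) (lim_compat b ji))).

Definition lim_mul a b : inverse_limit :=
  @InverseLimit (fun i => a i ⊙ b i) (fun i j ji =>
    etrans (residuated_morphism_mul (sys_map_morphism A ji) (a i) (b i))
           (f_equal2 _ (lim_compat a ji) (lim_compat b ji))).

Definition lim_imp a b : inverse_limit :=
  @InverseLimit (fun i => a i ⇒ b i) (fun i j ji =>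
    etrans (residuated_morphism_imp (sys_map_morphism A ji) (a i) (b i))
           (f_equal2 _ (lim_compat a ji) (lim_compat b ji))).

Definition lim_bot : inverse_limit :=
  @InverseLimit (fun=> \bot) (fun i j ji =>
    residuated_morphism_bot (sys_map_morphism A ji)).

Definition lim_top : inverse_limit :=
  @InverseLimit (fun=> \top) (fun i j ji =>
    residuated_morphism_top (sys_map_morphism A ji)).

Lemma lim_lexI a b c : (a <= lim_meet b c) = (a <= b) && (a <= c).
Proof.
apply/lim_leP/andP => [h|[/lim_leP ab /lim_leP ac] i].
  by split; apply/lim_leP => i; have := h i; rewrite lexI => /andP[].
by rewrite lexI ab ac.
Qed.

Lemma lim_leUx a b c : (lim_join a b <= c) = (a <= c) && (b <= c).
Proof.
apply/lim_leP/andP => [h|[/lim_leP ab /lim_leP ac] i].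
  by split; apply/lim_leP => i; have := h i; rewrite leUx => /andP[].
by rewrite leUx ab ac.
Qed.

HB.instance Definition _ := Order.POrder_MeetJoin_isLattice.Build d inverse_limit
  lim_lexI lim_leUx.

Lemma lim_le0x a : lim_bot <= a.
Proof. by apply/lim_leP => i; exact: le0x. Qed.

Lemma lim_lex1 a : a <= lim_top.
Proof. by apply/lim_leP => i; exact: lex1. Qed.

HB.instance Definition _ := Order.hasBottom.Build d inverse_limit lim_le0x.
HB.instance Definition _ := Order.hasTop.Build d inverse_limit lim_lex1.

Lemma lim_mulA : associative lim_mul.
Proof. by move=> a b c; apply: lim_ext => i; exact: rmulA. Qed.

Lemma lim_mulC : commutative lim_mul.
Proof. by move=> a b; apply: lim_ext => i; exact: rmulC. Qed.

Lemma lim_mul1x : left_id (\top : inverse_limit) lim_mul.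
Proof. by move=> a; apply: lim_ext => i; exact: rmul1x. Qed.

Lemma lim_mul_le a b c : (lim_mul a b <= c) = (a <= lim_imp b c).
Proof.
by apply/lim_leP/lim_leP => h i; have := h i; rewrite /= rmul_le.
Qed.

HB.instance Definition _ := isResiduated.Build d inverse_limit
  lim_mulA lim_mulC lim_mul1x lim_mul_le.

End InverseLimit.

Section QuotientSystem.
Context d (L : residuatedLatticeType d).
Local Open Scope classical_set_scope.

Definition filters_in (S : set (lfilter L)) : Type := {F : lfilter L | F \in S}.

Definition filter_in (S : set (lfilter L)) F (SF : S F) : filters_in S :=
  exist (fun F => F \in S) F (mem_set SF).

HB.instance Definition _ S := SubChoice.on (filters_in S).
HB.instance Definition _ S :=
  [SubChoice_isSubPOrder of filters_in S by <: with d].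

Lemma filters_in_subset (S : set (lfilter L)) (F G : filters_in S) :
  (G <= F)%O -> val F `<=` val G.
Proof. by move=> GF; apply/filter_leP; rewrite Order.le_val. Qed.

Definition quotient_system (S : set (lfilter L))
    (dirS : directed_poset (filters_in S)) : inverse_system d (filters_in S) :=
  @InverseSystem _ d (filters_in S) dirS
    (fun F => quotient (val F))
    (fun F G GF => quot_map (filters_in_subset GF))
    (fun F G GF => quot_map_morphism (filters_in_subset GF))
    (fun F FF => quot_map_id (filters_in_subset FF))
    (fun F G H GF HG HF =>
       quot_map_comp (filters_in_subset GF) (filters_in_subset HG)
                     (filters_in_subset HF)).

End QuotientSystem.

Section ProfiniteCompletion.
Context d (L : residuatedLatticeType d).
Local Open Scope classical_set_scope.

Definition finite_index_filters : set (lfilter L) :=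
  [set F | finite_set [set: quotient F]].

Lemma finite_index_full : finite_index_filters (full_filter L).
Proof.
apply: (@sub_finite_set _ _ [set quot_class (full_filter L) \top%O]).
  by apply: quotW => x _; apply/quot_classP/thetaP.
exact: finite_set1.
Qed.

Lemma finite_index_meet (F G : lfilter L) :
  finite_index_filters F -> finite_index_filters G ->
  finite_index_filters (filter_meet F G).
Proof.
move=> finF finG.
pose f (c : quotient (filter_meet F G)) :=
  (quot_class F (repr c), quot_class G (repr c)).
have finj : {in [set: quotient (filter_meet F G)] &, injective f}.
  move=> a b _ _ [/quot_classP/thetaP[F1 F2] /quot_classP/thetaP[G1 G2]].
  rewrite -[a]quot_classK -[b]quot_classK.
  by apply/quot_classP/thetaP; split; split.
rewrite /finite_index_filters/= -(eq_finite_set (inj_card_eq finj)).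
apply: sub_finite_set (finite_setX finF finG) => p _; by split.
Qed.

Lemma finite_index_directed : directed_poset (filters_in finite_index_filters).
Proof.
split; first by exists (filter_in finite_index_full).
move=> [F hF] [G hG].
exists (filter_in (finite_index_meet (set_mem hF) (set_mem hG))).
by rewrite -!Order.le_val /=; split; apply/filter_leP => x [].
Qed.

Definition profinite_completion : residuatedLatticeType d :=
  inverse_limit (quotient_system finite_index_directed).

Definition ji_filters : set (lfilter L) := [set J | join_irreducible J].

Definition ji1_filters : set (lfilter L) := ji_filters `|` [set trivial_filter L].

Lemma ji1_directed : directed_poset (filters_in ji1_filters).
Proof.
have h1 : ji1_filters (trivial_filter L) by right.
split; first by exists (filter_in h1).
move=> F G; exists (filter_in h1).
by rewrite -!Order.le_val /=; split; apply/filter_leP => x ->; exact: filter1.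
Qed.

Definition ji1_limit : residuatedLatticeType d :=
  inverse_limit (quotient_system ji1_directed).

Lemma finite_quotient (finL : finite_set [set: L]) (F : lfilter L) :
  finite_index_filters F.
Proof.
apply: sub_finite_set (finite_image (quot_class F) finL).
by apply: quotW => x _; exists x.
Qed.

Definition ji1_finite_index (finL : finite_set [set: L])
    (J : filters_in ji1_filters) : filters_in finite_index_filters :=
  filter_in (finite_quotient finL (val J)).

End ProfiniteCompletion.
Arguments profinite_completion {d} L.
Arguments ji1_filters {d} L.
Arguments ji1_limit {d} L.

(* Main.v *)
Require Import Defs.
From mathcomp Require Import all_boot all_order.
From mathcomp Require Import boolp classical_sets functions cardinality.

(** The trivial filter is the greatest element, for reverse inclusion, of both
    index posets, so in either limit a compatible family is determined by its
    component at [{1}], which may be any element of [L/{1}].  Restricting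
    families to the smaller index set is therefore an isomorphism. *)

Section Restriction.
Context {d : Order.disp_t} {L : residuatedLatticeType d}.
Local Open Scope classical_set_scope.

Lemma trivial_filter_subset (F : lfilter L) : trivial_filter L `<=` F.
Proof. by move=> x ->; exact: filter1. Qed.

Section TrivialIndex.
Context {S : set (lfilter L)} (dirS : directed_poset (filters_in S)).
Hypothesis S1 : S (trivial_filter L).

Definition extend_from_trivial (c : quotient (trivial_filter L)) :
    inverse_limit (quotient_system dirS) :=
  @InverseLimit _ _ _ (quotient_system dirS)
    (fun F => quot_map (trivial_filter_subset (val F)) c)
    (fun F G GF => quot_map_comp _ (filters_in_subset GF) _ c).

(** Every filter contains [{1}], so compatibility along the map from index [{1}] to index [F] forces
    the component at [F]. *)
Lemma extend_from_trivialK (a : inverse_limit (quotient_system dirS)) :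
  extend_from_trivial (a (filter_in S1)) = a.
Proof.
apply: lim_ext => F.
have F1 : (F <= filter_in S1)%O.
  by rewrite -Order.le_val; apply/filter_leP; exact: trivial_filter_subset.
(* The body of [quot_map] ignores its inclusion proof, so the two sides become convertible. *)
by rewrite -(lim_compat a F1).
Qed.

End TrivialIndex.

Context {S T : set (lfilter L)} (ST : S `<=` T).
Context (dirS : directed_poset (filters_in S)).
Context (dirT : directed_poset (filters_in T)).

Definition widen_index (F : filters_in S) : filters_in T :=
  filter_in (ST _ (set_mem (valP F))).

Lemma widen_index_le (F G : filters_in S) :
  (G <= F)%O -> (widen_index G <= widen_index F)%O.
Proof. by rewrite -!Order.le_val. Qed.

Definition restrict (a : inverse_limit (quotient_system dirT)) :
    inverse_limit (quotient_system dirS) :=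
  @InverseLimit _ _ _ (quotient_system dirS)
    (fun F => a (widen_index F))
    (fun F G GF => lim_compat a (widen_index_le F G GF)).

(** Operations in both limits are componentwise, and [restrict] only reindexes. *)
Lemma restrict_morphism : residuated_morphism restrict.
Proof. by split=> [a b|a b|a b|a b||]; apply: lim_ext. Qed.

(** The inverse takes the component at [{1}] and extends it to all of [T]; each composite reduces to
    [extend_from_trivialK], over [T] or over [S]. *)
Lemma restrict_bij : S (trivial_filter L) -> bijective restrict.
Proof.
move=> S1; have T1 := ST _ S1.
exists (fun b : inverse_limit (quotient_system dirS) =>
          extend_from_trivial dirT (b (filter_in S1))) => [a|b].
  rewrite -[RHS](extend_from_trivialK dirT T1) /=.
  (* The two indices at [{1}] differ only in their membership proofs. *)
  by congr (extend_from_trivial _ (lim_proj a (filter_in _))).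
rewrite -[RHS](extend_from_trivialK dirS S1); exact: lim_ext.
Qed.

End Restriction.

Theorem theorem5p11 (d : Order.disp_t) (L : residuatedLatticeType d)
    (finL : finite_set [set: L]%classic) :
  exists phi : profinite_completion L -> ji1_limit L,
    residuated_isomorphism phi /\
    forall (a : profinite_completion L) (J : filters_in (ji1_filters L)),
      lim_proj (phi a) J = lim_proj a (ji1_finite_index finL J).
Proof.
(* Since [L] is finite, every filter has a finite quotient. *)
have ST : (ji1_filters L `<=` @finite_index_filters d L)%classic.
  by move=> F _; exact: finite_quotient.
exists (restrict ST (ji1_directed L) (finite_index_directed L)); split.
  by split; [exact: restrict_morphism|apply: restrict_bij; right].
by move=> a J; congr (lim_proj a (filter_in _)); exact: Prop_irrelevance.
Qed.
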